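(* Let $\kappa$ be a regular uncountable cardinal and $\lambda>\kappa$ a cardinal. Suppose $\theta$ is an infinite cardinal $<\kappa$ such that $\kappa\to(\kappa,\theta)^2$. Then $H^+\xrightarrow{\kappa}(H^+,\theta+1)^2$ for every ideal $H$ on $P_\kappa(\lambda)$ such that $\mathrm{cof}(H)<\mathbf{cov}(\mathbf{M}_{\kappa,\kappa})$.
   Context: For a cardinal $\mu$ and a set $A$, $P_\mu(A)=\{a\subseteq A:|a|<\mu\}$. An ideal on an infinite set $S$ is a collection $K$ of subsets of $S$ containing all singletons, closed under subsets and finite unions, with $S\notin K$; $K^+=P(S)\setminus K$; $\mathrm{cof}(K)$ is the least cardinality of an $X\subseteq K$ with $K=\bigcup_{A\in X}P(A)$. $I_{\kappa,\lambda}$ is the set of all $A\subseteq P_\kappa(\lambda)$ such that $A\cap\{b\in P_\kappa(\lambda):a\subseteq b\}=\emptyset$ for some $a\in P_\kappa(\lambda)$. ''Ideal on $P_\kappa(\lambda)$'' always means an ideal $H$ on $P_\kappa(\lambda)$ that is $\kappa$-complete (closed under unions of fewer than $\kappa$ members) and fine ($I_{\kappa,\lambda}\subseteq H$). $\kappa\to(\kappa,\alpha)^2$ ($\alpha\ge 2$ an ordinal) means: for every $f:\{(\xi,\eta)\in\kappa\times\kappa:\xi<\eta\}\to 2$ there is $A\subseteq\kappa$ such that either $A$ has order type $\kappa$ and $f$ is identically $0$ on $[A]^2=\{(\xi,\eta)\in A\times A:\xi<\eta\}$, or $A$ has order type $\alpha$ and $f$ is identically $1$ on $[A]^2$. For $A\subseteq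 P_\kappa(\lambda)$, $[A]^2_\kappa=\{(\bigcup(a\cap\kappa),b):a,b\in A,\ \bigcup(a\cap\kappa)<\bigcup(b\cap\kappa)\}$. For $a,b\in P_\kappa(\lambda)$, $a\prec b$ means $a\subseteq b$ and $\bigcup(a\cap\kappa)<\bigcup(b\cap\kappa)$. For an ideal $H$ on $P_\kappa(\lambda)$ and an ordinal $\alpha$, $H^+\xrightarrow{\kappa}(H^+,\alpha)^2$ means: for every $F:[P_\kappa(\lambda)]^2_\kappa\to2$ and every $A\in H^+$ there is $B\subseteq A$ such that either $B\in H^+$ and $F$ is identically $0$ on $[B]^2_\kappa$, or $(B,\prec)$ has order type $\alpha$ and $F$ is identically $1$ on $[B]^2_\kappa$. $\mathbf{cov}(\mathbf{M}_{\kappa,\kappa})$: give ${}^\kappa2$ the topology whose basic open sets are $\emptyset$ and $O_s=\{f\in{}^\kappa2:s\subseteq f\}$ for $s\in\bigcup\{{}^a2:a\in P_\kappa(\kappa)\}$. $\mathbf{M}_{\kappa,\kappa}$ is the set of all $W\subseteq{}^\kappa2$ such that $W\cap\bigcap X=\emptyset$ for some collection $X$ of dense open sets with $0<|X|\le\kappa$. $\mathbf{cov}(\mathbf{M}_{\kappa,\kappa})$ is the least cardinality of a $Y\subseteq\mathbf{M}_{\kappa,\kappa}$ with $\bigcup Y={}^\kappa2$. *)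

(* Defs.v *)
From HB Require Import structures.
From mathcomp Require Import all_boot all_order.
From mathcomp Require Import all_classical topology_structure.
From mathcomp Require wochoice.

Set Implicit Arguments.
Unset Strict Implicit.
Unset Printing Implicit Defensive.

Import Order.TTheory.
Local Open Scope classical_set_scope.
Local Open Scope card_scope.
Local Open Scope order_scope.

Definition card_lt T U (A : set T) (B : set U) : Prop :=
  (A #<= B) /\ (A #!= B).
Notation "A '#<' B" := (card_lt A B)
  (at level 79, format "A  '#<'  B") : card_scope.

(* The least cardinality of a member of P, represented by a member of P that
   has it; by [least_cardP], such a member exists when P is nonempty. *)
Definition least_card T (P : set (set T)) : set T :=
  xget set0 [set X | P X /\ forall Y, P Y -> X #<= Y].

(* Take a maximal family F of choice functions on P any two of which differ
   at every member of P. By maximality the values of F exhaust some member X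
   of P, and then X embeds in every Y in P by g X |-> g Y. *)
Lemma least_cardP T (P : set (set T)) : P !=set0 ->
  P (least_card P) /\ forall Y, P Y -> least_card P #<= Y.
Proof.
move=> [X0 PX0].
suff exX : exists X, P X /\ forall Y, P Y -> X #<= Y.
  by rewrite /least_card; case: xgetP => [//|nX]; case: exX => X /nX.
pose good (F : set (set T -> T)) :=
  (forall g, F g -> forall Y, P Y -> Y (g Y)) /\
  (forall g h, F g -> F h -> forall Y, P Y -> g Y = h Y -> g = h).
have [|F [[Fin Finj] Fmax]] := @Zorn_bigcup _ good.
  move=> C Cgood Ctot; split=> [g [F CF Fg]|g h [F CF Fg] [G CG Gh]].
    exact: (Cgood _ CF).1.
  have [FG|GF] := Ctot _ _ CF CG.
    by apply: (Cgood _ CG).2 => //; apply: FG.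
  by apply: (Cgood _ CF).2 => //; apply: GF.
have [[X [PX sX]]|noX] := pselect (exists X, P X /\
    forall x, X x -> exists2 g, F g & g X = x).
  exists X; split=> // Y PY.
  have /choice[G GP] x : exists g, X x -> F g /\ g X = x.
    have [/sX[g Fg gx]|nX] := pselect (X x); first by exists g.
    by exists (fun=> x).
  suff [f] : $|{injfun X >-> Y}| by exact: inj_card_le.
  apply/injfunPex; exists (G^~ Y) => [x /GP[FG _]|x y].
    exact: (Fin _ FG Y PY).
  rewrite !inE => /GP[FGx Gx] /GP[FGy Gy] Gxy.
  by rewrite -Gx -Gy (Finj _ _ FGx FGy Y PY Gxy).
have new Y : P Y -> exists y, Y y /\ forall g, F g -> g Y <> y.
  move=> PY; apply: contrapT => noy; apply: noX; exists Y; split=> // x Yx.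
  apply: contrapT => nx; apply: noy; exists x; split=> // g Fg gx.
  by apply: nx; exists g.
have [x0 _] := new _ PX0.
have /choice[h hP] Y : exists y, P Y -> Y y /\ forall g, F g -> g Y <> y.
  have [/new[y yP]|nY] := pselect (P Y); first by exists y.
  by exists x0.
exfalso; apply: (Fmax (F `|` [set h])).
  split=> [g Fg|/(_ h (or_intror erefl)) Fh]; first by left.
  exact: (hP _ PX0).2 Fh erefl.
split=> [g [/Fin//|->] Y PY|g k [Fg|->] [Fk|->] Y PY gk //].
- exact: (hP _ PY).1.
- exact: Finj gk.
- by case: ((hP _ PY).2 g Fg).
- by case: ((hP _ PY).2 k Fk).
Qed.

(* Ordinals are the points of an arbitrary well-ordered type O. As for von
   Neumann ordinals, alpha is identified with the set of smaller ordinals; in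
   particular kappa is a subset of lambda when kappa < lambda. *)
Section Ordinals.
Context {d : Order.disp_t} {O : orderType d}.
Implicit Types (alpha xi eta kappa lambda : O).

Definition below alpha : set O := [set xi | xi < alpha].

(* Only meaningful when alpha is not the greatest point of O. *)
Definition osucc alpha : O :=
  xget alpha [set xi | alpha < xi /\ forall eta, alpha < eta -> xi <= eta].

Definition is_cardinal kappa : Prop :=
  forall xi, xi < kappa -> below xi #< below kappa.

Definition infinite_cardinal kappa : Prop :=
  is_cardinal kappa /\ infinite_set (below kappa).

Definition cofinal_in kappa (A : set O) : Prop :=
  A `<=` below kappa /\ forall xi, xi < kappa -> exists2 eta, A eta & xi <= eta.

(* The last clause says that the cofinality of kappa is kappa. *)
Definition regular_cardinal kappa : Prop :=
  infinite_cardinal kappa /\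
  forall A, cofinal_in kappa A -> below kappa #<= A.

Definition uncountable_cardinal kappa : Prop :=
  is_cardinal kappa /\ ~ countable (below kappa).

Definition has_order_type T (R : T -> T -> Prop) (B : set T) alpha : Prop :=
  exists f : O -> T, set_bij (below alpha) B f /\
    forall xi eta, xi < alpha -> eta < alpha ->
      (R (f xi) (f eta) <-> xi < eta).

(* kappa --> (kappa, alpha)^2. Only the values f xi eta for
   xi < eta < kappa matter, and [false] and [true] stand for 0 and 1. *)
Definition partition_arrow kappa alpha : Prop :=
  forall f : O -> O -> bool, exists2 A : set O, A `<=` below kappa &
    (has_order_type (fun xi eta => xi < eta) A kappa /\
      forall xi eta, A xi -> A eta -> xi < eta -> f xi eta = false) \/
    (has_order_type (fun xi eta => xi < eta) A alpha /\
      forall xi eta, A xi -> A eta -> xi < eta -> f xi eta = true).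

Definition Pk kappa lambda : set (set O) :=
  [set a | a `<=` below lambda /\ a #< below kappa].

(* \bigcup (a \cap kappa): the union of a set of ordinals is its supremum, which
   is 0 if the set is empty. The default value kappa is never used for a in
   P_kappa(lambda) with kappa regular. *)
Definition trace_sup kappa (a : set O) : O :=
  xget kappa (supremums (a `&` below kappa)).

Definition pairs_k kappa (A : set (set O)) : set (O * set O) :=
  [set p | exists a b, [/\ A a, A b, trace_sup kappa a < trace_sup kappa b
                         & p = (trace_sup kappa a, b)]].

Definition prec kappa (a b : set O) : Prop :=
  a `<=` b /\ trace_sup kappa a < trace_sup kappa b.

Definition I_kl kappa lambda : set (set (set O)) :=
  [set A | A `<=` Pk kappa lambda /\
     exists2 a, Pk kappa lambda a &
       A `&` [set b | Pk kappa lambda b /\ a `<=` b] = set0].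

End Ordinals.

Definition ideal_on T (S : set T) (K : set (set T)) : Prop :=
  [/\ forall A, K A -> A `<=` S,
      forall x, S x -> K [set x],
      forall A B, K A -> B `<=` A -> K B,
      forall A B, K A -> K B -> K (A `|` B)
    & ~ K S].

Definition positive T (S : set T) (K : set (set T)) : set (set T) :=
  [set A | A `<=` S /\ ~ K A].

Definition cof T (K : set (set T)) : set (set T) :=
  least_card [set X | X `<=` K /\ K = \bigcup_(A in X) [set B | B `<=` A]].

Section IdealsOnPk.
Context {d : Order.disp_t} {O : orderType d}.
Implicit Types (alpha kappa lambda : O) (H : set (set (set O))).

Definition ideal_on_Pk kappa lambda H : Prop :=
  [/\ ideal_on (Pk kappa lambda) H,
      forall X : set (set (set O)), X `<=` H -> X #< below kappa ->
        H (\bigcup_(A in X) A)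
    & I_kl kappa lambda `<=` H].

(* H^+ -->^kappa (H^+, alpha)^2. Only the values of F on
   [P_kappa(lambda)]^2_kappa matter. *)
Definition ideal_arrow kappa lambda H alpha : Prop :=
  forall (F : O * set O -> bool) (A : set (set O)),
    positive (Pk kappa lambda) H A ->
    exists2 B : set (set O), B `<=` A &
      (positive (Pk kappa lambda) H B /\
        forall p, pairs_k kappa B p -> F p = false) \/
      (has_order_type (prec kappa) B alpha /\
        forall p, pairs_k kappa B p -> F p = true).

End IdealsOnPk.

(* The space 2^kappa with the topology of base the sets O_s (the basic open set
   0 is an empty union of these). Regularity of kappa makes them a base. *)
Definition gcantor d (O : orderType d) (kappa : O)
    (kreg : regular_cardinal kappa) : Type :=
  set_type (below kappa) -> bool.

Section GeneralizedCantor.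
Context {d : Order.disp_t} {O : orderType d} {kappa : O}.
Variable kreg : regular_cardinal kappa.

HB.instance Definition _ := Choice.copy (gcantor kreg)
  (set_type (below kappa) -> bool).

(* O_s for s the restriction of p.2 to p.1, with p.1 in P_kappa(kappa) *)
Definition cylinder (p : set O * (O -> bool)) : set (gcantor kreg) :=
  [set f | forall x : set_type (below kappa), p.1 (val x) -> f x = p.2 (val x)].

Definition cylinder_dom : set (set O * (O -> bool)) :=
  [set p | Pk kappa kappa p.1].

Lemma small_bounded (A : set O) : A `<=` below kappa -> ~ (below kappa #<= A) ->
  exists2 eta, eta < kappa & forall xi, A xi -> xi < eta.
Proof.
move=> Ak nkA; apply: contrapT => nb; apply: nkA; apply: kreg.2; split=> // xi xk.
apply: contrapT => nx; apply: nb; exists xi => // eta Aeta.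
by rewrite ltNge; apply/negP => le; apply: nx; exists eta.
Qed.

Lemma PkU (a b : set O) : Pk kappa kappa a -> Pk kappa kappa b ->
  Pk kappa kappa (a `|` b).
Proof.
have PkN c : Pk kappa kappa c <-> c `<=` below kappa /\ ~ (below kappa #<= c).
  split=> [[ck [cle cne]]|[ck nkc]]; split=> //.
    by move=> kc; move/negP: cne; apply; rewrite card_eq_le cle kc.
  split; first exact: subset_card_le.
  by apply/negP; rewrite card_eq_le => /andP[_].
move=> /PkN[ak na] /PkN[bk nb]; apply/PkN; split; first by rewrite subUset.
move=> /card_leP[f0].
have /injfunPex[f fab finj] : $|{injfun below kappa >-> a `|` b}|.
  by squash (valLR kappa f0).
have preP c : ~ (below kappa #<= c) ->
    exists2 eta, eta < kappa & forall xi, xi < kappa -> c (f xi) -> xi < eta.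
  move=> nc; have [||eta ek lteta] := @small_bounded [set xi | xi < kappa /\ c (f xi)].
  - by move=> xi [].
  - move=> le; apply: nc; apply: card_le_trans le _.
    suff [g] : $|{injfun [set xi | xi < kappa /\ c (f xi)] >-> c}|.
      exact: inj_card_le.
    apply/injfunPex; exists f => [xi []//|xi eta].
    by rewrite !inE => -[xik _] [etak _]; apply: finj; rewrite inE.
  - by exists eta => // xi xik cxi; apply: lteta.
have [x xk ltx] := preP _ na; have [y yk lty] := preP _ nb.
have mk : Order.max x y < kappa by rewrite gt_max xk yk.
have [/(ltx _ mk)|/(lty _ mk)] : (a `|` b) (f (Order.max x y)).
- exact: fab.
- by rewrite gt_max ltxx.
- by rewrite gt_max ltxx andbF.
Qed.

Lemma cylinder_cover : \bigcup_(p in cylinder_dom) cylinder p = setT.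
Proof.
apply/seteqP; split=> // f _; exists (set0, fun=> false) => //.
apply: contrapT => n0.
have [||eta etak] := @small_bounded set0; first by [].
  rewrite card_le0 => /eqP k0.
  by case: kreg => -[_ +] _; rewrite k0; apply; exact: finite_set0.
move=> _; apply: n0; split; first by [].
split; first exact: card_ge0.
rewrite card_eq_sym card_eq0; apply/eqP => k0.
by have : below kappa eta := etak; rewrite k0.
Qed.

Lemma cylinder_join p q f : cylinder_dom p -> cylinder_dom q ->
  cylinder p f -> cylinder q f ->
  exists r, [/\ cylinder_dom r, cylinder r f
             & cylinder r `<=` cylinder p `&` cylinder q].
Proof.
move=> pk qk fp fq.
pose s xi :=
  if pselect (below kappa xi) is left h then f (SigSub (mem_set h)) else false.
have sE (x : set_type (below kappa)) : s (val x) = f x.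
  rewrite /s; case: pselect => [h|]; last by have /set_mem := valP x.
  by congr f; apply: val_inj.
exists (p.1 `|` q.1, s); split; first exact: PkU.
  by move=> x _; exact/esym/sE.
move=> g gr.
have gf x : (p.1 `|` q.1) (val x) -> g x = f x.
  by move=> /gr ->; exact: sE.
split=> x xa; rewrite gf.
- exact: fp.
- by left.
- exact: fq.
- by right.
Qed.

HB.instance Definition _ := isBaseTopological.Build (gcantor kreg)
  cylinder_cover cylinder_join.

Lemma open_gcantorP (U : set (gcantor kreg)) : open U <->
  exists2 D : set (set O * (O -> bool)), D `<=` cylinder_dom &
    \bigcup_(p in D) cylinder p = U.
Proof. by []. Qed.

End GeneralizedCantor.

Section Meager.
Context {d : Order.disp_t} {O : orderType d} {kappa : O}.
Variable kreg : regular_cardinal kappa.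

(* M_{kappa,kappa} *)
Definition k_meager : set (set (gcantor kreg)) :=
  [set W | exists X : set (set (gcantor kreg)),
     [/\ forall U, X U -> open U /\ dense U, X !=set0, X #<= below kappa
       & W `&` \bigcap_(U in X) U = set0]].

Definition cov_meager : set (set (gcantor kreg)) :=
  least_card [set Y | Y `<=` k_meager /\ \bigcup_(W in Y) W = setT].

End Meager.

Arguments cov_meager {d O kappa} kreg.

(* Main.v *)
Require Import Defs.
From mathcomp Require Import all_boot all_order.
From mathcomp Require Import all_classical topology_structure.
From mathcomp Require wochoice.

(* Write tr a for the supremum of a \cap kappa. Let A be positive, and suppose
   that no positive B included in A is 0-homogeneous. A Baire category argument
   in 2^kappa shows that every positive N included in A contains a set s(N) with
   fewer than kappa elements such that almost every b in N satisfies
   F(tr a, b) = 1 for some a in s(N). Repeatedly choosing such an a in s(N),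
   where N is the set of those elements of A that lie above all earlier choices
   and have colour 1 with them, associates to b a 1-homogeneous sequence of
   elements below b, which continues unless b falls into a null set depending
   only on the choices made so far. As kappa -> (kappa, theta)^2, a Sierpinski
   colouring shows that there are fewer than kappa sequences of choices of
   length less than theta. Hence almost every b in A has such a sequence of
   length theta, and b itself is put on top of it. *)

Set Implicit Arguments.
Unset Strict Implicit.
Unset Printing Implicit Defensive.

Import Order.TTheory.
Local Open Scope order_scope.
Local Open Scope classical_set_scope.
Local Open Scope card_scope.

(** * Comparison of cardinalities and the square of an infinite set *)

Lemma card_le_rel T U (A : set T) (B : set U) (R : T -> U -> Prop) :
  (forall x, A x -> exists2 y, B y & R x y) ->
  (forall x x' y, A x -> A x' -> R x y -> R x' y -> x = x') -> A #<= B.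
Proof.
move=> tot inj; have [[x0 /tot[y0 _ _]]|nA] := pselect (exists x, A x); last first.
  suff -> : A = set0 by exact: card_ge0.
  by apply/seteqP; split=> // x Ax; case: nA; exists x.
have /choice[f fP] x : exists y, A x -> B y /\ R x y.
  by have [/tot[y By Rxy]|nA] := pselect (A x); [exists y|exists y0].
suff [g] : $|{injfun A >-> B}| by exact: inj_card_le.
apply/injfunPex; exists f => [x /fP[]//|x y]; rewrite !inE => Ax Ay fxy.
by apply: (inj _ _ (f x) Ax Ay); [case: (fP _ Ax)|rewrite fxy; case: (fP _ Ay)].
Qed.

Lemma card_le_inj T U (A : set T) (B : set U) (f : T -> U) :
  (forall x, A x -> B (f x)) ->
  (forall x y, A x -> A y -> f x = f y -> x = y) -> A #<= B.
Proof.
move=> fAB finj; apply: (@card_le_rel _ _ _ _ (fun x y => y = f x)).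
  by move=> x Ax; exists (f x) => //; exact: fAB.
by move=> x x' y Ax Ax' -> /finj; apply.
Qed.

Lemma card_le_ex T U (u0 : U) (A : set T) (B : set U) : A #<= B ->
  exists2 f : T -> U, (forall x, A x -> B (f x)) &
    (forall x y, A x -> A y -> f x = f y -> x = y).
Proof.
move=> /card_leP[f0].
have /injfunPex[f fAB finj] : $|{injfun A >-> B}| by squash (valLR u0 f0).
by exists f => // x y Ax Ay; apply: finj; rewrite inE.
Qed.

(** Zorn's lemma gives a maximal partial injection between [A] and [B]. It is defined on all of [A]
    or reaches all of [B], since otherwise one more pair could be added. *)
Lemma card_le_total T U (A : set T) (B : set U) : A #<= B \/ B #<= A.
Proof.
pose good (R : set (T * U)) := (forall p, R p -> A p.1 /\ B p.2) /\
  (forall p q, R p -> R q -> (p.1 = q.1 <-> p.2 = q.2)).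
have [|R [[RAB Rinj] Rmax]] := @Zorn_bigcup _ good.
  move=> C Cgood Ctot; split=> [p [R CR Rp]|p q [R CR Rp] [S CS Sq]].
    exact: (Cgood _ CR).1.
  have [RS|SR] := Ctot _ _ CR CS.
    by apply: (Cgood _ CS).2 => //; apply: RS.
  by apply: (Cgood _ CR).2 => //; apply: SR.
have [tot|ntot] := pselect (forall x, A x -> exists2 y, B y & R (x, y)).
  left; apply: card_le_rel tot _ => x x' y _ _ Rx Rx'.
  exact: ((Rinj _ _ Rx Rx').2 erefl).
right; apply: (@card_le_rel _ _ _ _ (fun y x => R (x, y))) => [y By|y y' x _ _ Ry Ry'].
  apply: contrapT => ny; apply: ntot => x Ax; apply: contrapT => nx.
  apply: (Rmax (R `|` [set (x, y)])).
    split=> [p Rp|/(_ (x, y) (or_intror erefl)) Rxy]; first by left.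
    by apply: nx; exists y.
  split=> [p [/RAB//|->//]|p q [Rp|->] [Rq|->]] //=.
  - exact: Rinj.
  - split=> E; first by case: nx; exists p.2; [have [] := RAB _ Rp|rewrite -E -surjective_pairing].
    by case: ny; exists p.1; [have [] := RAB _ Rp|rewrite -E -surjective_pairing].
  - split=> E; first by case: nx; exists q.2; [have [] := RAB _ Rq|rewrite E -surjective_pairing].
    by case: ny; exists q.1; [have [] := RAB _ Rq|rewrite E -surjective_pairing].
exact: ((Rinj _ _ Ry Ry').1 erefl).
Qed.

(** [R] is meant as the graph of a map from [D * D] to [D]. Reading [D] off the diagonal spares a
    separate component for it in Zorn's lemma. *)
Definition pairing_dom T (R : set (T * T * T)) : set T :=
  [set x | exists z, R (x, x, z)].

Definition pairing_graph T (A : set T) (R : set (T * T * T)) : Prop :=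
  [/\ forall x y z, R (x, y, z) ->
        [/\ pairing_dom R x, pairing_dom R y & pairing_dom R z],
      pairing_dom R `<=` A,
      forall x y, pairing_dom R x -> pairing_dom R y -> exists z, R (x, y, z),
      forall p z z', R (p, z) -> R (p, z') -> z = z' &
      forall p p' z, R (p, z) -> R (p', z) -> p = p'].

Lemma pairing_graph_bigcup T (A : set T) (C : set (set (T * T * T))) :
  C `<=` pairing_graph A -> total_on C subset -> pairing_graph A (\bigcup_(R in C) R).
Proof.
move=> Cg Ctot.
have sub R : C R -> R `<=` \bigcup_(R in C) R by move=> CR p Rp; exists R.
have subd R : C R -> pairing_dom R `<=` pairing_dom (\bigcup_(R in C) R).
  by move=> CR x [z Rz]; exists z; apply: sub Rz.
have comp p q : (\bigcup_(R in C) R) p -> (\bigcup_(R in C) R) q ->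
    exists R, [/\ C R, R p & R q].
  move=> [R CR Rp] [S CS Sq]; have [RS|SR] := Ctot _ _ CR CS.
    by exists S; split=> //; apply: RS.
  by exists R; split=> //; apply: SR.
split.
- move=> x y z [R CR Rxyz]; have [/(_ _ _ _ Rxyz)[dx dy dz] _ _ _ _] := Cg _ CR.
  by split; apply: (subd _ CR).
- by move=> x [z [R CR Rx]]; have [_ RA _ _ _] := Cg _ CR; apply: RA; exists z.
- move=> x y [z Rx] [z' Ry]; have [R [CR Rx' Ry']] := comp _ _ Rx Ry.
  have [_ _ Rtot _ _] := Cg _ CR.
  by have [w Rw] := Rtot x y (ex_intro _ z Rx') (ex_intro _ z' Ry'); exists w, R.
- move=> p z z' Rz Rz'; have [R [CR]] := comp _ _ Rz Rz'.
  by have [_ _ _ + _] := Cg _ CR; apply.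
- move=> p p' z Rz Rz'; have [R [CR]] := comp _ _ Rz Rz'.
  by have [_ _ _ _ +] := Cg _ CR; apply.
Qed.

(* Zorn's lemma gives a maximal injection [D * D -> D] among those that extend
   one on a countable set. Then [D] has the cardinality of [A]: otherwise [D] is
   equipotent to some [D'] disjoint from it, and the new pairs of [D `|` D']
   can be coded in [D']. *)
Lemma card_setX_self T (A : set T) : infinite_set A -> A `*` A #<= A.
Proof.
move=> /infiniteP natA.
have [[t0 At0]|nA] := pselect (exists t, A t); last first.
  suff -> : A `*` A = set0 by exact: card_ge0.
  by apply/seteqP; split=> // -[x y] [Ax _]; case: nA; exists x.
have [e eA einj] := card_le_ex t0 natA.
have {}einj : injective e by move=> m n; exact: einj.
have {}eA n : A (e n) by exact: eA.
have [c _ cinj] : exists2 c : nat * nat -> nat, (forall x, setT x -> setT (c x)) &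
    forall x y, setT x -> setT y -> c x = c y -> x = y.
  by apply: (card_le_ex 0%N); rewrite (card_le_eql card_nat2).
pose R0 : set (T * T * T) :=
  [set p | exists m n, p = (e m, e n, e (c (m, n)))].
have dR0 x : pairing_dom R0 x <-> exists n, x = e n.
  split=> [[z [m [n [-> _ _]]]]|[n ->]]; first by exists m.
  by exists (e (c (n, n))), n, n.
have gR0 : pairing_graph A R0.
  split.
  - by move=> x y z [m [n [-> -> ->]]]; split; apply/dR0; [exists m|exists n|exists (c (m, n))].
  - by move=> x /dR0[n ->].
  - by move=> x y /dR0[m ->] /dR0[n ->]; exists (e (c (m, n))), m, n.
  - by move=> p z z' [m [n [-> ->]]] [m' [n' [/einj-> /einj-> ->]]].
  - by move=> p p' z [m [n [-> ->]]] [m' [n' [-> /einj/cinj]]] => /(_ I I)[-> ->].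
(* With [R0] adjoined to every member, the empty chain has the upper bound [R0]. *)
have [|R1 [gR Rmax]] := @Zorn_bigcup _ [set R | pairing_graph A (R `|` R0)].
  move=> C Cg Ctot /=.
  have -> : (\bigcup_(R in C) R) `|` R0 =
      \bigcup_(R in R0 |` [set R `|` R0 | R in C]) R.
    apply/seteqP; split=> [p [[R CR Rp]|R0p]|p [R [->|[S CS <-]]]].
    - by exists (R `|` R0); [right; exists R|left].
    - by exists R0 => //; left.
    - by right.
    - by move=> [Sp|]; [left; exists S|right].
  apply: pairing_graph_bigcup.
    by move=> R [->//|[S /Cg ? <-]].
  move=> _ _ [->|[S CS <-]] [->|[S' CS' <-]].
  - by left.
  - by left=> p; right.
  - by right=> p; right.
  - by have [SS|SS] := Ctot _ _ CS CS'; [left|right]; apply: setSU.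
pose R := R1 `|` R0; pose D := pairing_dom R.
have {}Rmax S : R `<=` S -> pairing_graph A S -> S `<=` R.
  move=> RS gS; apply: contrapT => nSR; apply: (Rmax (S `|` R0)).
    split=> [p R1p|SR1]; first by left; apply: RS; left.
    by apply: nSR => p Sp; left; apply: SR1; left.
  rewrite /=; suff -> : S `|` R0 `|` R0 = S by [].
  rewrite -setUA setUid; apply/seteqP; split=> [p [//|R0p]|p]; last by left.
  by apply: RS; right.
have [Rd DA Rtot Rfun Rinj] : pairing_graph A R by [].
have eD n : D (e n) by exists (e (c (n, n))); right; exists n, n.
have /choice[f fP] (p : T * T) : exists z, D p.1 -> D p.2 -> R (p, z).
  have [[d1 d2]|nd] := pselect (D p.1 /\ D p.2).
    by have [z Rz] := Rtot _ _ d1 d2; exists z; rewrite [p]surjective_pairing.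
  by exists t0 => d1 d2; case: nd.
have fD x y : D x -> D y -> D (f (x, y)).
  by move=> dx dy; have /Rd[] := fP (x, y) dx dy.
have finj x y x' y' : D x -> D y -> D x' -> D y' -> f (x, y) = f (x', y') ->
    x = x' /\ y = y'.
  move=> dx dy dx' dy' E; have R1' := fP (x, y) dx dy.
  have R2' := fP (x', y') dx' dy'; rewrite -E in R2'.
  by have [] := Rinj _ _ _ R1' R2'.
have e01 : e 0%N <> e 1%N by move/einj.
have e02 : e 0%N <> e 2%N by move/einj.
have e12 : e 1%N <> e 2%N by move/einj.
have [AD|DE] := card_le_total (A `\` D) D.
  have [h hD hinj] := card_le_ex t0 AD.
  (* The tags [e 0%N] and [e 1%N] keep [D] and the rest of [A] apart, so that [A] embeds in [D]. *)
  pose k x := if pselect (D x) then f (e 0%N, x) else f (e 1%N, h x).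
  have kD x : A x -> D (k x).
    by move=> Ax; rewrite /k; case: pselect => Dx; apply: fD => //; apply: hD.
  have kinj x y : A x -> A y -> k x = k y -> x = y.
    move=> Ax Ay; rewrite /k; case: pselect => Dx; case: pselect => Dy.
    - by move=> /finj[].
    - by move=> /finj[]//; apply: hD.
    - by move=> /finj[]//; [apply: hD|move/esym].
    - by move=> /finj[||||_ /hinj]; [exact: eD|exact: hD|exact: eD|exact: hD|apply].
  apply: (@card_le_inj _ _ _ _ (fun p => f (k p.1, k p.2))).
    by move=> [x y] [/= Ax Ay]; apply/DA/fD; exact: kD.
  move=> [x y] [x' y'] [/= Ax Ay] [/= Ax' Ay'] /finj[]; [exact: kD..|].
  by move=> /kinj -> // /kinj -> //.
have [phi phiE phiinj] := card_le_ex t0 DE.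
exfalso.
pose D2 := D `|` phi @` D.
have /choice[psi psiP] x : exists y, D2 x -> D y /\ (x = y \/ x = phi y).
  have [[Dx|[y Dy <-]]|n] := pselect (D2 x).
  - by exists x => _; split=> //; left.
  - by exists y => _; split=> //; right.
  - by exists x.
(* [psi] moves the coordinates of a pair back to [D], and the tag records where they came from. New
   pairs do not lie in [D * D], so three tags suffice. *)
pose tag x y : nat := if pselect (D x) then 0 else if pselect (D y) then 1 else 2.
pose f2 x y := phi (f (e (tag x y), f (psi x, psi y))).
pose S : set (T * T * T) := R `|` [set p | exists x y,
   [/\ p = (x, y, f2 x y), D2 x, D2 y & ~ (D x /\ D y)]].
have f2D x y : D2 x -> D2 y -> D (f (e (tag x y), f (psi x, psi y))).
  by move=> /psiP[dx _] /psiP[dy _]; apply: (fD) => //; apply: fD.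
have nphi x : D x -> ~ D (phi x) by move=> /phiE[].
have f2inj x y x' y' : D2 x -> D2 y -> D2 x' -> D2 y' ->
    ~ (D x /\ D y) -> ~ (D x' /\ D y') ->
    f2 x y = f2 x' y' -> x = x' /\ y = y'.
  move=> dx dy dx' dy' n n' /phiinj.
  move=> /(_ (f2D _ _ dx dy) (f2D _ _ dx' dy')).
  have [px xE] := psiP _ dx; have [py yE] := psiP _ dy.
  have [px' xE'] := psiP _ dx'; have [py' yE'] := psiP _ dy'.
  move=> /finj[//| | | |/einj]; [exact: fD|exact: eD|exact: fD|].
  move=> tagE /finj[]// psix psiy.
  have sides (z : T) w : D w -> z = w \/ z = phi w -> z = if pselect (D z) then w else phi w.
    by move=> Dw [->|->]; case: pselect => // d; case: (nphi w).
  have := sides _ _ px xE; have := sides _ _ py yE.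
  have := sides _ _ px' xE'; have := sides _ _ py' yE'.
  move: tagE n n'; rewrite /tag -psix -psiy.
  move: (psi x) (psi y) => a b.
  by do 4![case: pselect => ?] => // _ n n' -> -> -> ->; tauto.
have dS x : pairing_dom S x <-> D2 x.
  split=> [[z [Rz|[_ [_ [[-> _ _] //]]]]]|[[z Rz]|[y Dy <-]]].
  - by left; exists z.
  - by exists z; left.
  - exists (f2 (phi y) (phi y)); right; exists (phi y), (phi y).
    by split=> //; [right; exists y|right; exists y|move=> [/(nphi _ Dy)]].
have gS : pairing_graph A S.
  split.
  - move=> x y z [/Rd[dx dy dz]|[x' [y' [[-> -> ->] dx' dy' n]]]].
      by split; apply/dS; left.
    split; apply/dS => //; right; exists (f (e (tag x' y'), f (psi x', psi y'))) => //.
    exact: f2D.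
  - by move=> x /dS[/DA//|[y /phiE[Ay _] <-]].
  - move=> x y /dS dx /dS dy; have [[dx' dy']|n] := pselect (D x /\ D y).
      by have [z Rz] := Rtot _ _ dx' dy'; exists z; left.
    by exists (f2 x y); right; exists x, y.
  - move=> [x y] z z' [Rz|[x1 [y1 [[-> -> ->] d1 d2 n]]]].
      move=> [/(Rfun _ _ _ Rz)//|[x2 [y2 [[E1 E2 _] _ _ n]]]].
      by case: n; rewrite -E1 -E2; have [] := Rd _ _ _ Rz.
    by move=> [Rz'|[x2 [y2 [[-> -> ->]]]]//]; case: n; have [] := Rd _ _ _ Rz'.
  - move=> [x y] [x' y'] z [Rz|[x1 [y1 [[-> -> ->] d1 d2 n]]]].
      move=> [/(Rinj _ _ _ Rz)//|[x2 [y2 [[_ _ E] d1 d2 n]]]].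
      by have [_ _] := Rd _ _ _ Rz; rewrite E => /(nphi _ (f2D _ _ d1 d2)).
    move=> [/Rd[_ _ /(nphi _ (f2D _ _ d1 d2))//]|[x2 [y2 [[-> -> E] d1' d2' n']]]].
    by have [-> ->] := f2inj _ _ _ _ d1 d2 d1' d2' n n' E.
have SR : S `<=` R by apply: Rmax gS => p; left.
apply: (nphi (e 0%N)) => //; have : pairing_dom S (phi (e 0%N)).
  by apply/dS; right; exists (e 0%N).
by move=> [z /SR Rz]; exists z.
Qed.

Lemma card_lt_nle T U (A : set T) (B : set U) : A #< B <-> ~ (B #<= A).
Proof.
split=> [[AB nAB] BA|nBA]; first by move/negP: nAB; apply; rewrite card_eq_le AB.
have [AB|//] := card_le_total A B; split=> //.
by apply/negP; rewrite card_eq_le => /andP[_].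
Qed.

Lemma card_le_setU1 T U (A : set T) (x : T) (B : set U) :
  infinite_set B -> A #<= B -> A `|` [set x] #<= B.
Proof.
move=> Binf AB; have [u0 Bu0] := infinite_setN0 Binf.
have [f fAB finj] := card_le_ex u0 AB.
have [p pB pinj] := card_le_ex u0 (card_setX_self Binf).
have [u1 Bu1 u01] : exists2 u1, B u1 & u0 <> u1.
  apply: contrapT => n; apply: Binf; apply: sub_finite_set (finite_set1 u0) => u Bu.
  by apply: contrapT => uu0; apply: n; exists u => // E; apply: uu0.
(* The first coordinates [u0] and [u1] keep the new point apart from the points of [A]. *)
apply: (@card_le_inj _ _ _ _
    (fun y => p (if pselect (A y) then (u0, f y) else (u1, u1)))).
  by move=> y _; apply: pB; case: pselect => Ay; split=> //; exact: fAB.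
have {}pinj a b a' b' : B a -> B b -> B a' -> B b' -> p (a, b) = p (a', b') ->
    a = a' /\ b = b'.
  by move=> Ba Bb Ba' Bb' E; case: (pinj (a, b) (a', b') (conj Ba Bb) (conj Ba' Bb') E).
move=> y z yP zP; case: pselect => Ay; case: pselect => Az E.
- have [_] := pinj _ _ _ _ Bu0 (fAB _ Ay) Bu0 (fAB _ Az) E; exact: finj.
- by have [] := pinj _ _ _ _ Bu0 (fAB _ Ay) Bu1 Bu1 E.
- by have [/esym] := pinj _ _ _ _ Bu1 Bu1 Bu0 (fAB _ Az) E.
- by case: yP => // ->; case: zP => // ->.
Qed.

Lemma finite_card_le T U (A : set T) (B : set U) :
  finite_set A -> infinite_set B -> A #<= B.
Proof.
by move=> Afin Binf; have [//|/card_le_finite/(_ Afin)] := card_le_total A B.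
Qed.

(** * Well-orders, cofinality and the Sierpinski colouring *)

Section WellOrder.
Context {d : Order.disp_t} {O : orderType d}.
Variable O_wo : wochoice.well_order (<=%O : rel O).
Implicit Types (j k kappa theta nu xi eta : O) (g : O -> O -> O).

Lemma wo_min (P : set O) : P !=set0 -> exists2 x, P x & forall y, P y -> x <= y.
Proof.
move=> [x0 Px0]; have [|x [[Px xmin] _]] := O_wo (A := [pred x | `[< P x >]]).
  by exists x0; apply/asboolP.
exists x; first exact/asboolP.
by move=> y Py; apply: xmin; apply/asboolP.
Qed.

Lemma wo_ind (P : O -> Prop) : (forall x, (forall y, y < x -> P y) -> P x) ->
  forall x, P x.
Proof.
move=> Pind x; apply: contrapT => nPx.
have [|y nPy ymin] := @wo_min [set z | ~ P z]; first by exists x.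
apply: nPy; apply: Pind => z zy; apply: contrapT => /ymin.
by rewrite leNgt zy.
Qed.

Lemma le_cases (x y : O) : x <= y -> x = y \/ x < y.
Proof. by rewrite le_eqVlt => /orP[/eqP|]; [left|right]. Qed.

(** For a limit [M], this says that the cofinality of [M] exceeds the cardinality of [j]. *)
Definition cofinality_gt (M j : O) : Prop :=
  forall h : O -> O, (forall k, k < j -> h k < M) ->
    exists2 b, b < M & forall k, k < j -> h k <= b.

(** Induction on the coordinate [k]: the stages from which the earlier coordinates are constant have
    a common bound [s] below [M], and the last hypothesis turns [s] into a stage for [k]. Finally
    the stages of all coordinates are bounded together. *)
Lemma eventually_constant M j g m0 : m0 < M -> cofinality_gt M j ->
  (forall k s, k < j -> s < M ->
    (forall xi eta, s <= xi -> xi < M -> s <= eta -> eta < M ->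
       forall k', k' < k -> g xi k' = g eta k') ->
    exists2 t, t < M & s <= t /\
      forall xi, t <= xi -> xi < M -> g xi k = g t k) ->
  exists2 t, t < M & forall xi k, t <= xi -> xi < M -> k < j -> g xi k = g t k.
Proof.
move=> m0M Mj st.
suff /choice[h hP] k : exists t, k < j -> t < M /\
    forall xi, t <= xi -> xi < M -> g xi k = g t k.
  have [|t tM ht] := Mj h; first by move=> k /hP[].
  exists t => // xi k txi xiM kj; have [hM hE] := hP _ kj.
  by rewrite hE ?(le_trans (ht _ kj))// [RHS]hE// ht.
elim/wo_ind: k => k IH.
have [kj|nkj] := pselect (k < j); last by exists k. 
have /choice[h hP] l : exists t, t < M /\ (l < k ->
    forall xi, t <= xi -> xi < M -> g xi l = g t l).
  have [lk|nlk] := pselect (l < k); last by exists m0.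
  by have [t /(_ (lt_trans lk kj))[tM tP]] := IH l lk; exists t.
have [|s sM hs] := Mj h; first by move=> l _; case: (hP l).
have [|t tM [_ tP]] := st k s kj sM; last by exists t.
move=> xi eta sxi xiM seta etaM l lk; have lj := lt_trans lk kj.
by rewrite !(hP l).2 ?(le_trans (hs _ lj)).
Qed.

Lemma unbounded_no_max kappa xi : regular_cardinal kappa -> xi < kappa ->
  exists2 eta, eta < kappa & xi < eta.
Proof.
move=> kreg xik.
have [_ ->//|kx|eta etak xeta] := @small_bounded _ _ kappa kreg [set xi].
- apply: kreg.1.2; apply: card_le_finite kx _; exact: finite_set1.
- by exists eta => //; apply: xeta.
Qed.

Lemma regular_cofinality_gt kappa j : regular_cardinal kappa -> j < kappa ->
  cofinality_gt kappa j.
Proof.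
move=> kreg jk h hk.
have [_ [k kj <-]|kx|b bk hb] := @small_bounded _ _ kappa kreg (h @` below j).
- exact: hk.
- have /card_lt_nle[] := kreg.1.1 _ jk; apply: card_le_trans kx _.
  exact: card_image_le.
- by exists b => // k kj; apply/ltW/hb; exists k.
Qed.

(* [M] is the least infinite cardinal not embedding in [j], which is
   [omega] or a successor cardinal. *)
Lemma cofinality_gt_ex theta j : infinite_cardinal theta -> j < theta ->
  exists M, [/\ M <= theta, (forall xi, xi < M -> exists2 eta, eta < M & xi < eta),
     exists m, m < M & cofinality_gt M j].
Proof.
move=> [tcard tinf] jt.
have [|M [Minf Mj] Mmin] :=
  @wo_min [set M | infinite_set (below M) /\ ~ (below M #<= below j)].
  by exists theta; split=> //; apply/card_lt_nle/tcard.
have small xi : xi < M -> finite_set (below xi) \/ below xi #<= below j.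
  move=> xiM; have [fin|inf] := pselect (finite_set (below xi)); first by left.
  right; apply: contrapT => nle; have := Mmin xi (conj inf nle).
  by rewrite leNgt xiM.
have Mt : M <= theta by apply: Mmin; split=> //; apply/card_lt_nle/tcard.
have [m mM] : exists m, m < M by have /infinite_setN0 := Minf.
have nbig B : below M `<=` B -> finite_set B \/ B #<= below j -> False.
  move=> MB [Bfin|Bj]; first exact: Minf (sub_finite_set MB Bfin).
  by apply: Mj; apply: card_le_trans Bj; exact: subset_card_le.
exists M; split=> //; [|by exists m|].
  move=> xi xiM; apply: contrapT => n; apply: (nbig (below xi `|` [set xi])).
    move=> y yM; have [yxi|xiy|->] := ltgtP y xi; [by left| |by right].
    by case: n; exists y.
  have [fin|inf] := pselect (finite_set (below xi)).
    by left; rewrite finite_setU; split.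
  have [//|le] := small _ xiM; right; apply: card_le_setU1 (le).
  by move=> fin; apply: inf; apply: card_le_finite le fin.
move=> h hM; apply: contrapT => n.
(* If [h] is unbounded, the segments [below (h k)] cover [M]. Their union is finite when [j] is
   finite; otherwise it embeds in the square of [j], hence in [j]. *)
apply: (nbig (\bigcup_(k in below j) below (h k))).
  move=> b bM; apply: contrapT => nb; apply: n; exists b => // k kj.
  by rewrite leNgt; apply/negP => bh; apply: nb; exists k.
have [fin|inf] := pselect (finite_set (below j)); [left|right].
  apply: bigcup_finite => // k kj; have [//|le] := small _ (hM _ kj).
  exact: card_le_finite le fin.
have {}small k : k < j -> below (h k) #<= below j.
  by move=> /hM/small[fin|//]; exact: finite_card_le.
have /choice[e eP] k : exists f : O -> O, k < j ->
    (forall x, x < h k -> f x < j) /\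
    (forall x y, x < h k -> y < h k -> f x = f y -> x = y).
  have [kj|nkj] := pselect (k < j); last by exists id.
  by have [f f1 f2] := card_le_ex j (small _ kj); exists f.
apply: card_le_trans (card_setX_self inf).
apply: (@card_le_rel _ _ _ _ (fun x p => [/\ p.1 < j, x < h p.1 & p.2 = e p.1 x])).
  move=> x [k kj xh]; exists (k, e k x) => //; split=> //=.
  exact: (eP _ kj).1.
move=> x y [k l] _ _ [/= kj xh ->] [_ yh]; exact: (eP _ kj).2.
Qed.

(* If the functions [g xi] from [j] to [nu] were pairwise distinct, colour
   [xi < eta] with 1 iff [g eta] is lexicographically smaller than [g xi]. Both
   kinds of homogeneous sets give monotone sequences, all of whose coordinates
   are eventually constant. *)
Lemma few_functions kappa theta j nu g : regular_cardinal kappa ->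
  infinite_cardinal theta -> theta < kappa -> partition_arrow kappa theta ->
  j < theta -> nu < kappa ->
  (forall xi k, xi < kappa -> k < j -> g xi k < nu) ->
  exists xi eta, [/\ xi < eta, eta < kappa & forall k, k < j -> g xi k = g eta k].
Proof.
move=> kreg tcard tk arrow jt nuk gnu; apply: contrapT => ndist.
pose lexlt (a b : O -> O) :=
  exists k, [/\ k < j, forall k', k' < k -> a k' = b k' & a k < b k].
have lex_le a b k :
    (forall k', k' < k -> a k' = b k') -> lexlt a b -> a k <= b k.
  move=> E [l [lj El ltl]]; have [lk|kl|<-] := ltgtP l k.
  - by move: ltl; rewrite E// ltxx.
  - by rewrite El.
  - exact: ltW.
have dist xi eta : xi < eta -> eta < kappa -> lexlt (g xi) (g eta) \/ lexlt (g eta) (g xi).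
  move=> xe ek; have [k [kj nk] kmin] :
      exists2 k, k < j /\ g xi k <> g eta k & forall l, l < j /\ g xi l <> g eta l -> k <= l.
    apply: wo_min; apply: contrapT => n; apply: ndist; exists xi, eta; split=> // k kj.
    by apply: contrapT => ne; apply: n; exists k.
  have E l : l < k -> g xi l = g eta l.
    move=> lk; apply: contrapT => ne; have := kmin l (conj (lt_trans lk kj) ne).
    by rewrite leNgt lk.
  have [lt|gt|//] := ltgtP (g xi k) (g eta k); [left|right]; exists k; split=> //.
  by move=> l /E.
have [A Ak [[[u [[uA _ _] uord]] A0]|[[u [[uA _ _] uord]] A1]]] :=
  arrow (fun xi eta => `[< lexlt (g eta) (g xi) >]).
- have ule xi eta k : xi < eta -> eta < kappa -> k < j ->
      (forall k', k' < k -> g (u xi) k' = g (u eta) k') ->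
      g (u xi) k <= g (u eta) k.
    move=> xe ek kj; have xk := lt_trans xe ek.
    have [Ax Ae] := (uA _ xk, uA _ ek); have uxe := (uord _ _ xk ek).2 xe.
    have [lx|lx] := dist _ _ uxe (Ak _ Ae); first by move=> E; exact: lex_le E lx.
    by have /asboolPn := A0 _ _ Ax Ae uxe.
  have jk := lt_trans jt tk.
  have [k s kj sk E|t tk' tP] :=
      @eventually_constant kappa j (g \o u) j jk (regular_cofinality_gt kreg jk).
    (* [h v] is a stage at which the value [v] is taken, if it is taken after [s] at all. Fewer than
       [kappa] values occur, so these stages have a bound [t]; a nondecreasing coordinate whose
       later values were all taken by stage [t] is constant from [t] on. *)
    have /choice[h hP] v : exists xi, [/\ s <= xi, xi < kappa &
        forall eta, s <= eta -> eta < kappa -> g (u eta) k = v -> g (u xi) k = v].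
      have [[xi [sxi xik gv]]|n] :=
          pselect (exists xi, [/\ s <= xi, xi < kappa & g (u xi) k = v]).
        by exists xi.
      by exists s; split=> // eta se ek gv; case: n; exists eta.
    have [|t tk' ht] := @regular_cofinality_gt kappa nu kreg nuk h.
      by move=> v _; case: (hP v).
    have gux xi : xi < kappa -> g (u xi) k < nu by move=> xk; apply/gnu/kj/Ak/uA.
    have st : s <= t by have [+ _ _] := hP (g (u s) k); move=> /le_trans; apply; exact/ht/gux.
    exists t => //; split=> // xi txi xik /=.
    have [sh hk hE] := hP (g (u xi) k).
    apply: le_anti; apply/andP; split; last first.
      have [->//|{}txi] := le_cases txi.
      by apply: ule => // k' k'k; apply: E => //; exact: le_trans (ltW txi).
    rewrite -(hE xi (le_trans st txi) xik erefl).
    have [->//|hlt] := le_cases (ht _ (gux _ xik)).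
    by apply: ule => // k' k'k; apply: E.
  have [t' t'k tt'] := unbounded_no_max kreg tk'.
  have ut := (uord _ _ tk' t'k).2 tt'.
  apply: ndist; exists (u t), (u t'); split=> //; first exact/Ak/uA.
  by move=> k kj; apply/esym/tP => //; exact: ltW.
(* [theta] may be singular, so only an initial part of the homogeneous set is used, of a length [M]
   with large enough cofinality. *)
- have [M [Mt Mlim [m mM] Mcof]] := cofinality_gt_ex tcard jt.
  have ule xi eta k : xi < eta -> eta < M -> k < j ->
      (forall k', k' < k -> g (u xi) k' = g (u eta) k') ->
      g (u eta) k <= g (u xi) k.
    move=> xe eM kj E; have et := lt_le_trans eM Mt.
    have xt := lt_trans xe et; have uxe := (uord _ _ xt et).2 xe.
    have /asboolP := A1 _ _ (uA _ xt) (uA _ et) uxe.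
    by apply: lex_le => // k' /E.
  have [k s kj sM E|t tM tP] := @eventually_constant M j (g \o u) m mM Mcof.
    (* A nonincreasing coordinate is constant once it has reached its least value. *)
    have [|v [t [st tM gt]] vmin] :=
        @wo_min [set v | exists t, [/\ s <= t, t < M & g (u t) k = v]].
      by exists (g (u s) k), s.
    exists t => //; split=> // xi txi xiM /=; apply: le_anti; apply/andP; split.
      have [->//|{}txi] := le_cases txi.
      apply: ule => // k' k'k; apply: E => //; exact: le_trans (ltW txi).
    by rewrite gt; apply: vmin; exists xi; split=> //; exact: le_trans txi.
  have [t' t'M tt'] := Mlim _ tM.
  have [tt t't] := (lt_le_trans tM Mt, lt_le_trans t'M Mt).
  have ut := (uord _ _ tt t't).2 tt'.
  apply: ndist; exists (u t), (u t'); split=> //; first exact/Ak/uA.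
  by move=> k kj; apply/esym/tP => //; exact: ltW.
Qed.
End WellOrder.

(** * Counting the nodes of the tree of choices *)

Section Tree.
Context {d : Order.disp_t} {O : orderType d}.
Variable O_wo : wochoice.well_order (<=%O : rel O).
Implicit Types (j k kappa theta nu xi eta : O).

(** An injection of [kappa] into the union would, by regularity, send only a bounded set of ordinals
    into each piece. These bounds have a common bound [b], and then [b] could be sent into no
    piece. *)
Lemma not_card_le_bigcup I T kappa (D : set I) (G : I -> set T) :
  regular_cardinal kappa -> ~ (below kappa #<= D) ->
  (forall i, D i -> ~ (below kappa #<= G i)) ->
  ~ (below kappa #<= \bigcup_(i in D) G i).
Proof.
move=> kreg nD nG kG; have [k0 k0k] := infinite_setN0 kreg.1.2.
have [t0 _] : \bigcup_(i in D) G i !=set0.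
  apply/set0P/eqP => G0; move: kG; rewrite G0 card_le0 => /eqP k0'.
  by rewrite k0' in k0k.
have [f fG finj] := card_le_ex t0 kG.
have /choice[h hP] i : exists b, D i -> b < kappa /\
    forall x, x < kappa -> G i (f x) -> x < b.
  have [Di|nDi] := pselect (D i); last by exists k0.
  have [x []//|le|b bk hb] :=
      @small_bounded _ _ kappa kreg [set x | x < kappa /\ G i (f x)].
  - apply: (nG _ Di); apply: card_le_trans le _.
    by apply: (@card_le_inj _ _ _ _ f) => [x []//|x y [xk _] [yk _]]; exact: finj.
  - by exists b => _; split=> // x xk Gx; apply: hb.
have [_ [i Di <-]|le|b bk hb] := @small_bounded _ _ kappa kreg (h @` D).
- exact: (hP _ Di).1.
- by apply: nD; apply: card_le_trans le _; exact: card_image_le.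
have [i Di Gi] := fG _ bk; have := hb (h i); rewrite lt_gtF; last exact: (hP _ Di).2.
by move=> /(_ (imageP _ Di)).
Qed.

(** Induction on [j]: by regularity, the candidates at all levels below [j] form a set [V] of fewer
    than [kappa] elements, coded by ordinals below some [nu < kappa]. Then [kappa] distinct nodes
    would give [kappa] distinct functions from [j] to [nu], against [few_functions]. *)
Lemma few_nodes kappa theta j T B (a : O -> B -> T) (S : set T -> set T) :
  regular_cardinal kappa ->
  infinite_cardinal theta -> theta < kappa -> partition_arrow kappa theta ->
  (forall N, ~ (below kappa #<= S N)) -> j < theta ->
  ~ (below kappa #<= [set [set a k b | k in below j] |
       b in [set b | forall k, k < j -> S [set a l b | l in below k] (a k b)]]).
Proof.
move=> kreg tcard tk arrow nS; elim/(wo_ind O_wo): j => j IH jt.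
set node := fun k b => [set a l b | l in below k].
set ok := fun k => [set b | forall l, l < k -> S (node l b) (a l b)].
pose V := \bigcup_(k in below j) \bigcup_(N in node k @` ok k) S N.
have nV : ~ (below kappa #<= V).
  apply: not_card_le_bigcup => // [|k kj].
    by apply/card_lt_nle/kreg.1.1; exact: lt_trans tk.
  by apply: not_card_le_bigcup => //; apply: IH => //; exact: lt_trans jt.
have Vk : V #<= below kappa by have [] := card_le_total V (below kappa).
have [e eV einj] := card_le_ex kappa Vk.
have [_ [x Vx <-]|le|nu nuk enu] := @small_bounded _ _ kappa kreg (e @` V).
- exact: eV.
- by apply: nV; apply: card_le_trans le _; exact: card_image_le.
move=> /(card_le_ex set0)[f fT finj].
have /choice[b bP] xi : exists b, xi < kappa -> ok j b /\ node j b = f xi.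
  have [k0 k0k] := infinite_setN0 kreg.1.2.
  have [xik|nxik] := pselect (xi < kappa); first by have [b ? ?] := fT _ xik; exists b.
  by have [b _ _] := fT _ k0k; exists b.
have aV xi k : xi < kappa -> k < j -> V (a k (b xi)).
  move=> xik kj; have [okb _] := bP _ xik.
  exists k => //; exists (node k (b xi)); last exact: okb.
  by exists (b xi) => // l lk; apply: okb; exact: lt_trans kj.
have [|xi [eta [xe ek E]]] := few_functions O_wo kreg tcard tk arrow jt nuk
    (g := fun xi k => e (a k (b xi))).
  by move=> xi k xik kj; apply: enu; exists (a k (b xi)) => //; exact: aV.
have xk := lt_trans xe ek.
suff /finj : f xi = f eta by move=> /(_ xk ek) xieta; rewrite xieta ltxx in xe.
rewrite -(bP _ xk).2 -(bP _ ek).2; apply: eq_imagel => k kj.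
exact: einj (aV _ _ xk kj) (aV _ _ ek kj) (E _ kj).
Qed.
End Tree.

(** * Recursion along the ordinals *)

Section Recursion.
Context {d : Order.disp_t} {O : orderType d}.
Variable O_wo : wochoice.well_order (<=%O : rel O).

(** Well-founded recursion on [k] with [b] as a parameter. Only the set of earlier values is passed
    on, since a node is such a set. *)
Lemma path_ex T B (c : set T -> B -> T) : exists a : O -> B -> T,
  forall k b, a k b = c [set a j b | j in below k] b.
Proof.
have wf : well_founded (fun x y : O => x < y).
  by move=> x; elim/(wo_ind O_wo): x => x IH; constructor.
pose step (k : O) (rec : forall j, j < k -> B -> T) b :=
  c [set t | exists (j : O) (jk : j < k), rec j jk b = t] b.
exists (Fix wf (fun=> B -> T) step) => k b.
rewrite Fix_eq; last first.
  move=> x f g fg; congr step; apply: functional_extensionality_dep => y.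
  by apply: functional_extensionality_dep => p; exact: fg.
congr c; apply/seteqP; split=> t.
  by move=> [j [jk <-]]; exists j.
by move=> [j jk <-]; exists j, jk.
Qed.
End Recursion.

(** * Null sets of the ideal and the category argument *)

Section Ideal.
Context {d : Order.disp_t} {O : orderType d}.
Variable O_wo : wochoice.well_order (<=%O : rel O).
Variables kappa lambda : O.
Hypothesis kreg : regular_cardinal kappa.
Hypothesis kl : kappa < lambda.
Implicit Types (a b : set O).

(** By regularity the part of [a] below [kappa] is bounded in [kappa], so the default value of
    [trace_sup] is not taken. *)
Lemma trace_supP a : Pk kappa lambda a ->
  trace_sup kappa a < kappa /\ forall x, a x -> x < kappa -> x <= trace_sup kappa a.
Proof.
move=> [al /card_lt_nle ka].
have [x []//|le|e ek ltx] := @small_bounded _ _ kappa kreg (a `&` below kappa).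
  by apply: ka; apply: card_le_trans le _; apply: subset_card_le => x [].
have [|t tub tmin] := wo_min O_wo (P := ubound (a `&` below kappa)).
  by exists e => x /ltx/ltW.
suff tsup : supremums (a `&` below kappa) (trace_sup kappa a).
  split=> [|x ax xk]; last by apply: tsup.1.
  by apply: le_lt_trans ek; apply: tsup.2 => x /ltx/ltW.
by apply: xgetPex; exists t.
Qed.

Section FixedIdeal.
Variable H : set (set (set O)).
Hypothesis Hid : ideal_on_Pk kappa lambda H.

Lemma ideal_sub A B : H A -> B `<=` A -> H B.
Proof. by have [[_ _ + _ _] _ _] := Hid; apply. Qed.

Lemma ideal_setU A B : H A -> H B -> H (A `|` B).
Proof. by have [[_ _ _ + _] _ _] := Hid; apply. Qed.

Lemma ideal_bigcup I (D : set I) (G : I -> set (set O)) :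
  ~ (below kappa #<= D) -> (forall i, D i -> H (G i)) ->
  H (\bigcup_(i in D) G i).
Proof.
move=> nD HG; have [_ Hk _] := Hid.
have -> : \bigcup_(i in D) G i = \bigcup_(A in G @` D) A.
  apply/seteqP; split=> [x [i Di Gx]|x [_ [i Di <-] Gx]]; last by exists i.
  by exists (G i) => //; exists i.
apply: Hk => [_ [i Di <-]|]; first exact: HG.
by apply/card_lt_nle => le; apply: nD; apply: card_le_trans le (card_image_le _ _).
Qed.

Lemma ideal_not_above a : Pk kappa lambda a -> H [set b | Pk kappa lambda b /\ ~ a `<=` b].
Proof.
move=> Pa; have [_ _ HI] := Hid; apply: HI; split=> [b []//|].
by exists a => //; apply/seteqP; split=> // b [[_ nab] []].
Qed.

Lemma Pk_set1 x : x < kappa -> Pk kappa lambda [set x].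
Proof.
move=> xk; split=> [_ ->|]; first exact: lt_trans kl.
apply/card_lt_nle => le; apply: kreg.1.2; apply: card_le_finite le _.
exact: finite_set1.
Qed.

(** Almost every [b] includes [a] and contains some [x < kappa] above the trace of [a], which forces
    the trace of [b] above that of [a]. *)
Lemma ideal_not_prec a : Pk kappa lambda a ->
  H [set b | Pk kappa lambda b /\ ~ prec kappa a b].
Proof.
move=> Pa; have [ak _] := trace_supP Pa.
have [x xk ax] := unbounded_no_max kreg ak.
apply: ideal_sub (ideal_setU (ideal_not_above Pa) (ideal_not_above (Pk_set1 xk))) _.
move=> b [Pb nab]; have [sab|] := pselect (a `<=` b); last by left.
right; split=> // /(_ _ erefl) bx; apply: nab; split=> //.
by apply: lt_le_trans ax _; apply: (trace_supP Pb).2.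
Qed.

Lemma cofP : [/\ cof H `<=` H & forall B, H B -> exists2 A, cof H A & B `<=` A].
Proof.
have [|[sub eqH] _] := @least_cardP _
    [set X | X `<=` H /\ H = \bigcup_(A in X) [set B | B `<=` A]].
  exists H; split=> //; apply/seteqP; split=> [A HA|A [B HB AB]]; first by exists A.
  exact: ideal_sub HB AB.
by split=> // B; rewrite {1}eqH => -[A XA BA]; exists A.
Qed.

(* The homogeneous set is
   [B_D = {b in A | tr b in D, F(x, b) = 0 for all x in D with x < tr b}] for a
   [D] avoiding fewer than [cov(M)] nowhere dense sets, one for each member of a
   cofinal subset of [H]. *)
Lemma homogeneous0 (F : O * set O -> bool) A :
  cof H #< cov_meager kreg -> positive (Pk kappa lambda) H A ->
  (forall s, s `<=` A -> ~ (below kappa #<= s) ->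
     ~ H [set b | A b /\ forall a, s a -> F (trace_sup kappa a, b) = false]) ->
  exists2 B, B `<=` A & positive (Pk kappa lambda) H B /\
    forall p, pairs_k kappa B p -> F p = false.
Proof.
move=> /card_lt_nle ncov [APk nHA] Apos.
set tr := trace_sup kappa.
have trk b : A b -> tr b < kappa by move=> /APk/trace_supP[].
(* A point of the space is read as a subset of [kappa]. *)
pose mem (D : gcantor kreg) x := exists2 y : set_type (below kappa), val y = x & D y.
pose E := tr @` A.
pose B_ D := [set b | [/\ A b, mem D (tr b) &
  forall x, E x -> mem D x -> x < tr b -> F (x, b) = false]].
pose U_ X : set (gcantor kreg) := [set D | exists2 b, B_ D b & ~ X b].
have memE (D D' : gcantor kreg) t :
    (forall y : set_type (below kappa), val y <= t -> D y = D' y) ->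
    forall x, x <= t -> mem D x -> mem D' x.
  by move=> DD' x xt [y yx Dy]; exists y => //; rewrite -DD' ?yx.
have Uopen X : open (U_ X).
  apply/open_gcantorP; exists [set p | cylinder_dom (kappa := kappa) p /\
    cylinder (kreg := kreg) p `<=` U_ X].
    by move=> p [].
  apply/seteqP; split=> [D [p [_ pU] Dp]|D [b [Ab Db Fb] nXb]]; first exact: pU.
  (* Whether [b] belongs to [B_ D] depends only on the part of [D] up to [tr b]. *)
  exists ([set x | x <= tr b], fun x => `[< mem D x >]).
    split; [split=> /=|].
    - by move=> x /= xb; apply: le_lt_trans xb _; exact: trk.
    - have [t tk bt] := unbounded_no_max kreg (trk _ Ab).
      apply/card_lt_nle => le; have /card_lt_nle := kreg.1.1 _ tk; apply.
      apply: card_le_trans le _; apply: subset_card_le => x /= xb.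
      exact: le_lt_trans bt.
    - move=> D' D'p; exists b => //.
      have DD' (y : set_type (below kappa)) : val y <= tr b -> D y = D' y.
        move=> yb; rewrite D'p//=; apply/idP/asboolP => [Dy|[z zy]]; first by exists y.
        by have -> : z = y by exact: val_inj.
      split=> //; first by apply: memE Db => //; exact: DD'.
      move=> x Ex Dx xb; apply: Fb => //.
      by apply: (memE D' D (tr b)) (ltW xb) Dx => y /DD'.
  move=> y /= yb; apply/idP/asboolP => [Dy|[z zy]]; first by exists y.
  by have -> : z = y by exact: val_inj.
have Udense X : H X -> dense (U_ X).
  move=> HX V [f Vf] /open_gcantorP[W Wk WV].
  have [p Wp fp] : (\bigcup_(p in W) cylinder (kreg := kreg) p) f by rewrite WV.
  have [pk /card_lt_nle npk] := Wk _ Wp.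
  have [//|/npk//|dl dlk pdl] := @small_bounded _ _ kappa kreg p.1.
  have /choice[r rP] x : exists a, E x -> A a /\ tr a = x.
    by have [[a Aa ax]|nE] := pselect (E x); [exists a|exists set0].
  (* Colours depend on the first element only through its trace, so one representative of each trace
     that the cylinder puts into the set suffices. *)
  pose s := r @` [set x | [/\ p.1 x, E x & mem f x]].
  have [b [[Ab Fb] [nXb dlb]]] : exists b,
      (A b /\ forall a, s a -> F (tr a, b) = false) /\ (~ X b /\ b dl).
    apply: contrapT => nb; apply: (Apos s).
    - by move=> _ [x [_ Ex _] <-]; case: (rP _ Ex).
    - move=> le; apply: npk; apply: card_le_trans le _.
      apply: card_le_trans (card_image_le _ _) _.
      by apply: subset_card_le => x [].
    apply: ideal_sub (ideal_setU HX (ideal_not_above (Pk_set1 dlk))) _ => b bP.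
    have [Xb|nXb] := pselect (X b); [by left|right].
    split=> [|/(_ _ erefl) bdl]; first exact/APk/bP.1.
    by apply: nb; exists b.
  have dltr : dl <= tr b by apply: (trace_supP (APk _ Ab)).2.
  (* Beyond the part of [f] fixed by the cylinder, [f'] contains only [tr b]. As [dl] belongs to
     [b], this point lies above [p.1], so [f'] stays in the cylinder and only the traces represented
     in [s] constrain [b]. *)
  pose f' : gcantor kreg := fun y => (`[< p.1 (val y) >] && f y) || (val y == tr b).
  exists f'; split.
    rewrite -WV; exists p => // y py; rewrite /f' (asboolT py)/= (fp _ py).
    by rewrite (lt_eqF (lt_le_trans (pdl _ py) dltr)) orbF.
  exists b => //; split=> //.
    by exists (SigSub (mem_set (trk _ Ab : below kappa (tr b)))); rewrite ?/f'/= ?eqxx ?orbT.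
  move=> x Ex [y yx]; rewrite /f' yx.
  move=> /orP[/andP[/asboolP px fy] xb|/eqP ->]; last by rewrite ltxx.
  have [Ar <-] := rP _ Ex; apply: Fb; exists x => //; split=> //.
  by exists y.
have [cofH Hcof] := cofP.
have [D DU] : exists D, forall X, cof H X -> U_ X D.
  (* Otherwise the complements of the sets [U_ X] cover the space, and each of them misses a single
     dense open set. *)
  apply: contrapT => nD; apply: ncov.
  pose Y := [set ~` U_ X | X in cof H].
  apply: card_le_trans (card_image_le (fun X => ~` U_ X) _).
  have YP : Y `<=` @k_meager _ _ _ kreg /\ \bigcup_(W in Y) W = setT.
    split=> [_ [X cX <-]|].
      exists [set U_ X]; split.
      - by move=> _ ->; split; [exact: Uopen|apply: Udense; exact: cofH].
      - by exists (U_ X).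
      - have [k0 k0k] := infinite_setN0 kreg.1.2.
        by apply: (@card_le_inj _ _ _ _ (fun=> k0)) => // x y -> ->.
      - by rewrite bigcap_set1; exact: setICl.
    apply/seteqP; split=> // D _; apply: contrapT => nYD; apply: nD; exists D => X cX.
    by apply: contrapT => nU; apply: nYD; exists (~` U_ X) => //; exists X.
  have [|_] := @least_cardP _ [set Y | Y `<=` @k_meager _ _ _ kreg /\
      \bigcup_(W in Y) W = setT]; first by exists Y.
  exact.
exists (B_ D); first by move=> b [].
split.
  split; first by move=> b [/APk].
  by move=> /Hcof[X cX BX]; have [b Bb] := DU _ cX; apply; exact: BX.
move=> _ [a [b [[Aa Da _] [Ab _ Fb] ab ->]]]; apply: Fb => //.
by exists a.
Qed.

End FixedIdeal.
End Ideal.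

(** * The successor of [theta] and the 1-homogeneous sequence *)

(** As [kappa] lies above [theta], the default value of [osucc] is not taken. *)
Lemma osuccP d (O : orderType d) (O_wo : wochoice.well_order (<=%O : rel O))
    (theta kappa xi : O) : theta < kappa -> xi < osucc theta <-> xi <= theta.
Proof.
move=> tk; have [|s ts smin] := wo_min O_wo (P := [set x | theta < x]).
  by exists kappa.
have [tt ttmin] : theta < osucc theta /\ forall eta, theta < eta -> osucc theta <= eta.
  by apply: (@xgetPex _ theta [set x | theta < x /\ forall y, theta < y -> x <= y]); exists s.
split=> [xs|/le_lt_trans]; last exact.
by rewrite leNgt; apply/negP => /ttmin; rewrite leNgt xs.
Qed.

Theorem theorem10p5 (d : Order.disp_t) (O : orderType d)
    (O_wo : wochoice.well_order (<=%O : rel O))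
    (kappa lambda theta : O)
    (kappa_regular : regular_cardinal kappa)
    (kappa_uncountable : uncountable_cardinal kappa)
    (lambda_cardinal : is_cardinal lambda)
    (kappa_lt_lambda : (kappa < lambda)%O)
    (theta_infinite : infinite_cardinal theta)
    (theta_lt_kappa : (theta < kappa)%O)
    (kappa_theta : partition_arrow kappa theta) :
  forall H : set (set (set O)), ideal_on_Pk kappa lambda H ->
    (cof H #< cov_meager kappa_regular)%card ->
    ideal_arrow kappa lambda H (osucc theta).
Proof.
move=> H Hid cofcov F A [APk nHA]; apply: contrapT => nB.
set tr := trace_sup kappa.
pose R a b := prec kappa a b /\ F (tr a, b) = true.
pose above N := [set b | A b /\ forall a, N a -> R a b].
pose stuck N s := [set b | above N b /\ forall a, s a -> ~ R a b].
(* The empty set serves if [above N] is null. Otherwise [homogeneous0] applies to [above N], where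
   failure would give a positive 0-homogeneous set. *)
have /choice[S SP] N : exists s, [/\ ~ (below kappa #<= s), s `<=` above N & H (stuck N s)].
  have [HN|nHN] := pselect (H (above N)).
    exists set0; split=> //; last by apply: (ideal_sub Hid HN) => b [].
    rewrite card_le0 => /eqP k0; have := infinite_setN0 kappa_regular.1.2.
    by rewrite k0 => -[].
  apply: contrapT => ns; apply: nB.
  have [||B BN [Bpos BF]] := homogeneous0 O_wo kappa_lt_lambda Hid cofcov
      (A := above N) (F := F); last by exists B => [b /BN[]//|]; left.
    by split=> // b [/APk].
  move=> s sN nks Hs; apply: ns; exists s; split=> //.
  (* [homogeneous0] speaks of colours only, while [R] also requires [prec]; the difference is null
     by [kappa]-completeness. *)
  pose np := \bigcup_(a in s) [set b | Pk kappa lambda b /\ ~ prec kappa a b].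
  have Hnp : H np.
    apply: (ideal_bigcup Hid) => // a /sN[/APk Pa _].
    exact: (ideal_not_prec O_wo kappa_regular).
  apply: (ideal_sub Hid (ideal_setU Hid Hs Hnp)) => b [Nb nR].
  have [|n] := pselect (np b); [by right|left; split=> // a sa].
  apply/negP => Fab; apply: (nR _ sa); split=> //.
  by apply: contrapT => nab; apply: n; exists a => //; split=> //; apply/APk; case: Nb.
(* The default [set0] is returned when no candidate fits; below [theta] this does not happen for [b]
   in [A] outside [bad]. *)
pose c N b := xget set0 [set a | S N a /\ R a b].
have [x xE] := path_ex O_wo c.
pose node k b := [set x j b | j in below k].
pose ok k := [set b | forall j, j < k -> S (node j b) (x j b)].
pose bad := \bigcup_(k in below theta) \bigcup_(N in node k @` ok k) stuck N (S N).
have Hbad : H bad.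
  apply: (ideal_bigcup Hid) => [|k kt].
    exact/card_lt_nle/kappa_regular.1.1.
  apply: (ideal_bigcup Hid) => [|N _]; last by case: (SP N).
  apply: (few_nodes O_wo kappa_regular theta_infinite theta_lt_kappa) => // N.
  by case: (SP N).
have [b Ab nbad] : exists2 b, A b & ~ bad b.
  apply: contrapT => n; apply: nHA; apply: (ideal_sub Hid Hbad) => b Ab.
  by apply: contrapT => nb; apply: n; exists b.
have xP k : k < theta -> S (node k b) (x k b) /\ R (x k b) b.
  elim/(wo_ind O_wo): k => k IH kt.
  have {}IH j : j < k -> S (node j b) (x j b) /\ R (x j b) b.
    by move=> jk; apply: IH => //; exact: lt_trans kt.
  rewrite [x k b]xE; apply: (@xgetPex _ set0 [set a | S (node k b) a /\ R a b]).
  apply: contrapT => n; apply: nbad; exists k => //; exists (node k b).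
    by exists b => // j /IH[].
  split=> [|a Sa Rab]; last by apply: n; exists a.
  by split=> // _ [j /IH[_ ?] <-].
have xx j k : j < k -> k < theta -> R (x j b) (x k b).
  move=> jk kt; have [_ SN _] := SP (node k b).
  by have [/SN[_ NR] _] := xP _ kt; apply: NR; exists j.
have xA k : k < theta -> A (x k b).
  by move=> /xP[+ _]; have [_ SN _] := SP (node k b); move=> /SN[].
(* Position [theta] holds [b] itself, which makes the length [theta + 1]. *)
pose f xi := if xi < theta then x xi b else b.
have osE := osuccP O_wo _ theta_lt_kappa.
have fR xi eta : xi < eta -> eta < osucc theta -> R (f xi) (f eta).
  move=> xe /osE/le_cases[E|et].
    by move: xe; rewrite E /f ltxx => xt; rewrite xt; have [] := xP _ xt.
  by rewrite /f et (lt_trans xe et); exact: xx.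
apply: nB; exists (f @` below (osucc theta)).
  by move=> _ [xi _ <-]; rewrite /f; case: ifPn => // /xA.
right; split.
  (* Traces increase strictly along [f], so [prec] reflects the order of the indices. *)
  have fprec xi eta : xi < osucc theta -> eta < osucc theta ->
      prec kappa (f xi) (f eta) <-> xi < eta.
    move=> xo eo; split=> [[_ trlt]|xe]; last by case: (fR _ _ xe eo).
    have [//|ex|E] := ltgtP xi eta; last by rewrite E ltxx in trlt.
    by have [[_ /lt_trans/(_ trlt)]] := fR _ _ ex xo; rewrite ltxx.
  exists f; split=> //; split; [by move=> xi xo; exists xi| |by []].
  move=> xi eta; rewrite !inE => xo eo E.
  have [lt|gt|//] := ltgtP xi eta.
    by have /fprec[//|//|_] := lt; rewrite E ltxx.
  by have /fprec[//|//|_] := gt; rewrite E ltxx.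
move=> _ [_ [_ [[xi xo <-] [eta eo <-] trlt ->]]].
have [lt|gt|E] := ltgtP xi eta; last by rewrite E ltxx in trlt.
  exact: (fR _ _ lt eo).2.
by have [[_ /lt_trans/(_ trlt)]] := fR _ _ gt xo; rewrite ltxx.
Qed.
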